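(* Fix $K\ge 2$, $L\ge1$ and vectors $\mathbf a=(a_1,\dots,a_L),\mathbf b=(b_1,\dots,b_L)\in\mathbb{R}_+^L$, and let $u=\sum_\ell a_\ell$, $v=\sum_\ell b_\ell$. Consider the weighted stochastic block model with $K$ communities each of size $n$, where each pair of vertices independently receives a color in $\{0,1,\dots,L\}$ distributed as $p_n$ if both endpoints are in the same community and as $q_n$ otherwise, with \[ p_n(0)=1-\frac{u\log n}{n},\quad p_n(\ell)=\frac{a_\ell\log n}{n},\qquad q_n(0)=1-\frac{v\log n}{n},\quad q_n(\ell)=\frac{b_\ell\log n}{n}\quad(1\le\ell\le L). \] If \[ \sum_{\ell=1}^L\big(\sqrt{a_\ell}-\sqrt{b_\ell}\big)^2>1, \] then the maximum likelihood estimator recovers the communities exactly with probability converging to $1$ as $n\to\infty$. *)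

(* Defs.v *)
From HB Require Import structures.
From mathcomp Require Import all_boot all_order all_algebra all_fingroup.
From mathcomp Require Import all_classical all_reals all_analysis.
Set Implicit Arguments. Unset Strict Implicit. Unset Printing Implicit Defensive.
Import Order.TTheory GRing.Theory Num.Theory.
Local Open Scope ring_scope.

(* Vertex (k, i): the i-th vertex of community k.  K communities of size n. *)
Definition vtx (K n : nat) := ('I_K * 'I_n)%type.

(* Unordered pairs of distinct vertices, represented as ordered pairs
   (x, y) with rank x < rank y. *)
Definition upair (K n : nat) :=
  {x : vtx K n * vtx K n | (enum_rank x.1 < enum_rank x.2)%N}.

(* Colors: None = color 0 (no edge), Some l = color l+1, l : 'I_L. *)
Definition graph (K L n : nat) := {ffun upair K n -> option 'I_L}.

Definition colprob (R : realType) (L : nat) (c : 'I_L -> R) (n : nat)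
    (o : option 'I_L) : R :=
  match o with
  | None => 1 - (\sum_(l < L) c l) * ln (n%:R) / n%:R
  | Some l => c l * ln (n%:R) / n%:R
  end.

Definition lik (R : realType) (K L : nat) (a b : 'I_L -> R) (n : nat)
    (s : {ffun vtx K n -> 'I_K}) (w : graph K L n) : R :=
  \prod_(e : upair K n)
    (if s (val e).1 == s (val e).2 then colprob a n (w e)
     else colprob b n (w e)).

Definition truth (K n : nat) : {ffun vtx K n -> 'I_K} := [ffun x => x.1].

Definition balanced (K n : nat) (s : {ffun vtx K n -> 'I_K}) : bool :=
  [forall k : 'I_K, #|[set x | s x == k]| == n].

Definition same_partition (K n : nat) (s t : {ffun vtx K n -> 'I_K}) : bool :=
  [exists pi : {perm 'I_K}, [forall x, s x == pi (t x)]].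

Definition mle_success (R : realType) (K L : nat) (a b : 'I_L -> R) (n : nat)
    (w : graph K L n) : bool :=
  [forall s : {ffun vtx K n -> 'I_K},
     (balanced s && ~~ same_partition s (truth K n)) ==>
     (lik a b s w < lik a b (truth K n) w)].

(* Probability of exact recovery: the law of w is lik a b (truth K n). *)
Definition prob_success (R : realType) (K L : nat) (a b : 'I_L -> R) (n : nat)
    : R :=
  \sum_(w : graph K L n | mle_success a b w) lik a b (truth K n) w.

(* Main.v *)
(* If P and Q are the laws of the graph under the true partition t and under a
   competitor s, then P(lik t <= lik s) <= sum sqrt (P Q), which factors over the
   m pairs of vertices whose status (same / different community) differs in s and
   t.  Each factor is at most exp (- D/2 * ln n / n), where
   D = sum_l (sqrt a_l - sqrt b_l)^2.
   Let n_ij be the number of vertices of community i labelled j by s.  Then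
   m = sum_x (n - n_(t x)(s x)).  Fix q large with D (1 - 1/q) > 1.
   Either some row of (n_ij) has all entries below (1 - 1/q) n; then m >= n^2 / q
   and exp (- c n ln n) beats the K^(Kn) labellings.  Or, as column sums are n,
   the large entries of the rows form a permutation, and after relabelling
   n_ii >= (1 - 1/q) n for all i.  Then m >= 2 (1 - 1/q) n d, where d is the
   Hamming distance from s to t, and with r = n^(- D (1 - 1/q)) the sum of r^d
   over all s <> t is at most (1 + K r)^(Kn) - 1, which tends to 0 since
   n r tends to 0. *)
Require Import Defs.
From HB Require Import structures.
From mathcomp Require Import all_boot all_order all_algebra all_fingroup.
From mathcomp Require Import all_classical all_reals all_analysis.
From mathcomp Require Import ring lra zify.
Import Order.TTheory GRing.Theory Num.Theory numFieldNormedType.Exports.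
Local Open Scope ring_scope.
Local Open Scope classical_set_scope.
Set Implicit Arguments. Unset Strict Implicit. Unset Printing Implicit Defensive.

(** * Finite sums, products and square roots *)

Lemma sum_option (V : nmodType) (T : finType) (F : option T -> V) :
  \sum_o F o = F None + \sum_x F (Some x).
Proof.
rewrite (bigD1 None) //=; congr (_ + _).
rewrite (reindex_omap Some id) //=; last by case.
by apply: eq_bigl => x; rewrite eqxx.
Qed.

Lemma sqrtr_prod (R : rcfType) (I : finType) (F : I -> R) :
  (forall i, 0 <= F i) -> Num.sqrt (\prod_i F i) = \prod_i Num.sqrt (F i).
Proof.
move=> F0; elim/big_rec2: _ => [|i x y _ <-]; first exact: sqrtr1.
exact: sqrtrM.
Qed.

(** The square root splits over the product, and expanding a product of sums over [J] yields one
    term for each function [w]. *)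
Lemma sum_sqrt_prod (R : rcfType) (I J : finType) (f g : I -> J -> R) :
  (forall i j, 0 <= f i j) -> (forall i j, 0 <= g i j) ->
  \sum_(w : {ffun I -> J})
     Num.sqrt ((\prod_i f i (w i)) * \prod_i g i (w i)) =
  \prod_i \sum_j Num.sqrt (f i j * g i j).
Proof.
move=> f0 g0; rewrite bigA_distr_bigA; apply: eq_bigr => w _.
by rewrite -big_split sqrtr_prod // => i; rewrite mulr_ge0.
Qed.

(* Chernoff bound at exponent 1/2: [P <= sqrt (P * Q)] on the event. *)
Lemma sum_le_sqrt (R : rcfType) (T : finType) (P Q : T -> R) :
  (forall w, 0 <= P w) ->
  \sum_(w | P w <= Q w) P w <= \sum_w Num.sqrt (P w * Q w).
Proof.
move=> P0; rewrite big_mkcond; apply: ler_sum => w _.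
case: ifP => [PQ|_]; last exact: sqrtr_ge0.
by rewrite -{1}(ger0_norm (P0 w)) -sqrtr_sqr ler_wsqrtr // expr2 ler_wpM2l.
Qed.

(** AM-GM: the square of the right side exceeds the product by [((x - y) / 2) ^+ 2]. *)
Lemma sqrt1B_le (R : rcfType) (x y : R) : x <= 1 -> y <= 1 ->
  Num.sqrt ((1 - x) * (1 - y)) <= 1 - (x + y) / 2.
Proof.
move=> x1 y1; have h : 0 <= 1 - (x + y) / 2 by lra.
rewrite -[leRHS]ger0_norm // -sqrtr_sqr ler_wsqrtr //.
rewrite -subr_ge0 (_ : _ - _ = ((x - y) / 2) ^+ 2) ?sqr_ge0 //.
by field.
Qed.

(** * Color laws and their Bhattacharyya coefficient *)

Section ColorDistribution.
Variables (R : realType) (L n : nat) (c : 'I_L -> R).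
Hypotheses (n0 : (0 < n)%N) (c0 : forall l, 0 <= c l).
Hypothesis c1 : (\sum_l c l) * ln (n%:R) / n%:R <= 1.

Lemma ln_nat_ge0 : 0 <= ln (n%:R : R).
Proof. by rewrite ln_ge0 // ler1n. Qed.

Lemma colprob_ge0 o : 0 <= colprob c n o.
Proof.
case: o => [l|] /=; last by rewrite subr_ge0.
by rewrite divr_ge0 // mulr_ge0 // ln_nat_ge0.
Qed.

Lemma colprob_sum1 : \sum_o colprob c n o = 1.
Proof. by rewrite sum_option /= -!mulr_suml subrK. Qed.
End ColorDistribution.

Definition divergence (R : realType) (L : nat) (a b : 'I_L -> R) : R :=
  \sum_(l < L) (Num.sqrt (a l) - Num.sqrt (b l)) ^+ 2.

(** With [y = ln n / n], color 0 contributes at most [1 - (u + v) y / 2] and color [l] contributes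
    [sqrt (a l * b l) * y]. The total is at most [1 - D y / 2], with [D] the divergence, and
    [1 + x <= expR x] concludes. *)
Lemma bhattacharyya_le (R : realType) (L n : nat) (a b : 'I_L -> R) :
  (0 < n)%N -> (forall l, 0 <= a l) -> (forall l, 0 <= b l) ->
  (\sum_l a l) * ln (n%:R) / n%:R <= 1 ->
  (\sum_l b l) * ln (n%:R) / n%:R <= 1 ->
  \sum_o Num.sqrt (colprob a n o * colprob b n o) <=
  expR (- (divergence a b / 2 * (ln n%:R / n%:R))).
Proof.
move=> n0 a0 b0 a1 b1; rewrite sum_option /=.
set y := ln _ / _; have y0 : 0 <= y by rewrite divr_ge0 // ln_nat_ge0.
rewrite -!mulrA -/y in a1 b1 *.
apply: le_trans (expR_ge1Dx _).
apply: le_trans (lerD (sqrt1B_le a1 b1) (lexx _)) _.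
under eq_bigr => l _.
  rewrite -!(mulrA _ (ln _)) -/y mulrACA sqrtrM ?mulr_ge0 // -expr2 sqrtr_sqr ger0_norm //.
  rewrite sqrtrM //; over.
rewrite -mulr_suml.
have -> : divergence a b = \sum_l a l + \sum_l b l
    - 2 * \sum_l Num.sqrt (a l) * Num.sqrt (b l).
  rewrite mulr_sumr -big_split -sumrB; apply: eq_bigr => l _ /=.
  by rewrite sqrrB !sqr_sqrtr //; ring.
by rewrite le_eqVlt; apply/orP; left; apply/eqP; field.
Qed.

Definition changed_pairs (K n : nat) (s t : {ffun vtx K n -> 'I_K}) : nat :=
  \sum_(e : upair K n)
    ((s (val e).1 == s (val e).2) != (t (val e).1 == t (val e).2)).

(** Ties count as errors, matching the strict inequality in [mle_success]. *)
Definition error_prob (R : realType) (K L n : nat) (a b : 'I_L -> R)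
    (t s : {ffun vtx K n -> 'I_K}) : R :=
  \sum_(w : graph K L n | lik a b t w <= lik a b s w) lik a b t w.

(** * Likelihoods, pairwise error bound and union bound *)

Section Likelihood.
Variables (R : realType) (K L n : nat) (a b : 'I_L -> R).
Hypotheses (n0 : (0 < n)%N).
Hypotheses (a0 : forall l, 0 <= a l) (b0 : forall l, 0 <= b l).
Hypothesis a1 : (\sum_l a l) * ln (n%:R) / n%:R <= 1.
Hypothesis b1 : (\sum_l b l) * ln (n%:R) / n%:R <= 1.
Implicit Types s t : {ffun vtx K n -> 'I_K}.

Let color s (e : upair K n) (o : option 'I_L) : R :=
  if s (val e).1 == s (val e).2 then colprob a n o else colprob b n o.

Let color_ge0 s e o : 0 <= color s e o.
Proof. by rewrite /color; case: ifP => _; exact: colprob_ge0. Qed.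

Let likE s w : lik a b s w = \prod_e color s e (w e).
Proof. by []. Qed.

Lemma lik_ge0 s w : 0 <= lik a b s w.
Proof. by rewrite likE; apply: prodr_ge0 => e _; exact: color_ge0. Qed.

Lemma lik_sum1 s : \sum_w lik a b s w = 1.
Proof.
rewrite -[LHS]/(\sum_(w : graph K L n) \prod_e color s e (w e)).
rewrite -(bigA_distr_bigA (color s)) big1 // => e _.
by rewrite /color; case: (s _ == _); exact: colprob_sum1.
Qed.

Lemma error_prob_le t s :
  error_prob a b t s <=
  expR (- (divergence a b / 2 * (ln n%:R / n%:R))) ^+ changed_pairs s t.
Proof.
apply: le_trans (sum_le_sqrt _ _) _ => [w|]; first exact: lik_ge0.
rewrite -[leLHS]/(\sum_(w : graph K L n)
  Num.sqrt ((\prod_e color t e (w e)) * \prod_e color s e (w e))).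
rewrite (sum_sqrt_prod (color_ge0 t) (color_ge0 s)).
rewrite /changed_pairs expr_sum; apply: ler_prod => e _.
rewrite sumr_ge0 => /= [|o _]; last exact: sqrtr_ge0.
(* A pair of unchanged status contributes the total mass of one color law, so its factor is exactly
   1. *)
have same c : (forall l, 0 <= c l) ->
    (\sum_l c l) * ln (n%:R) / n%:R <= 1 ->
    \sum_o Num.sqrt (colprob c n o * colprob c n o) = 1.
  move=> c0 c1; rewrite -(colprob_sum1 n c); apply: eq_bigr => o _.
  by rewrite -expr2 sqrtr_sqr ger0_norm // colprob_ge0.
rewrite /color; case: (s _ == _); case: (t _ == _) => /=.
- by rewrite expr0 same.
- under eq_bigr => o _ do rewrite mulrC.
  by rewrite expr1; exact: bhattacharyya_le.
- by rewrite expr1; exact: bhattacharyya_le.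
- by rewrite expr0 same.
Qed.

Lemma lik_partition s s' w : (forall x y, (s x == s y) = (s' x == s' y)) ->
  lik a b s w = lik a b s' w.
Proof. by move=> e; apply: eq_bigr => i _; rewrite e. Qed.

Lemma prob_success_le1 : prob_success K a b n <= 1.
Proof.
rewrite -(lik_sum1 (truth K n)) [leRHS](bigID (@mle_success R K L a b n)) /=.
by rewrite lerDl sumr_ge0 // => w _; exact: lik_ge0.
Qed.

(** The likelihood depends only on the induced partition, so the union bound may run over any set
    [C] that represents every wrong partition. This leaves the choice of a favourable
    relabelling. *)
Lemma prob_success_ge (C : pred {ffun vtx K n -> 'I_K}) :
  (forall s, balanced s -> ~~ same_partition s (truth K n) ->
   exists2 s', C s' & forall x y, (s x == s y) = (s' x == s' y)) ->
  1 - \sum_(s | C s) error_prob a b (truth K n) s <= prob_success K a b n.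
Proof.
move=> repr.
rewrite lerBlDr -(lik_sum1 (truth K n)) [leLHS](bigID (@mle_success R K L a b n)) /=.
rewrite lerD2l /error_prob (exchange_big_dep xpredT) //=.
rewrite [leLHS]big_mkcond; apply: ler_sum => w _.
rewrite /mle_success; case: ifP => [|_]; last first.
  by rewrite sumr_ge0 // => *; exact: lik_ge0.
case/forallPn => s; rewrite negb_imply -leNgt => /andP[/andP[bs ns] le].
have [s' Cs' es'] := repr s bs ns.
rewrite (bigD1 s') /=; last by rewrite Cs' -(lik_partition w es').
by rewrite lerDl sumr_ge0 // => *; exact: lik_ge0.
Qed.
End Likelihood.

(** * Combinatorics of the confusion matrix *)

Section Confusion.
Local Open Scope nat_scope.
Variables (V I : finType) (n : nat).
Implicit Types s t : V -> I.

Definition confusion t s i j := \sum_x ((t x == i) && (s x == j)).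

Definition fibers_card s := forall i, \sum_x (s x == i) = n.

Definition unmatched t s := \sum_x (n - confusion t s (t x) (s x)).

(** For fixed [x], the [y] whose status changes form the symmetric difference of two fibers of size
    [n] meeting in [confusion t s (t x) (s x)] points. *)
Lemma sum_changed_pairs s t : fibers_card s -> fibers_card t ->
  \sum_x \sum_y ((s x == s y) != (t x == t y)) = (unmatched t s).*2.
Proof.
move=> ns nt; rewrite /unmatched -mul2n big_distrr; apply: eq_bigr => x _ /=.
suff: \sum_y ((s x == s y) != (t x == t y)) +
    2 * confusion t s (t x) (s x) = n + n by lia.
rewrite -{1}(ns (s x)) -(nt (t x)) big_distrr -!big_split.
apply: eq_bigr => y _ /=; rewrite (eq_sym (s y)) (eq_sym (t y)).
by case: (s x == s y); case: (t x == t y).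
Qed.

(** Misplaced and correctly placed vertices [x] each account for [h] times the Hamming distance,
    whence the factor 2. *)
Lemma unmatched_near s t h : fibers_card t ->
  (forall i, h <= confusion t s i i) ->
  2 * h * \sum_x (s x != t x) <= unmatched t s.
Proof.
move=> nt hi.
have conf x : confusion t s (t x) (s x) +
    \sum_y ((t y == t x) && (s y != s x)) = n.
  rewrite -(nt (t x)) -big_split; apply: eq_bigr => y _ /=.
  by case: (t y == t x); case: (s y == s x).
rewrite /unmatched [leqRHS](bigID (fun x => s x != t x)) /=.
rewrite -mulnA mul2n -addnn; apply: leq_add.
  (* A misplaced [x] is separated by [s] from all the correctly placed vertices of its true
     community, at least [h] of them. *)
  rewrite mulnC big_distrl /= [leqRHS]big_mkcond leq_sum // => x _.
  case: ifP => sx; last by rewrite mul0n.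
  rewrite mul1n -(conf x) addKn; apply: leq_trans (hi (t x)) _.
  apply: leq_sum => y _; case: (t y == t x) => //=.
  by case: eqP => [->|//]; rewrite eq_sym sx.
(* Double counting: each misplaced [y] is counted once by every correctly placed [x] of its true
   community. *)
apply: (@leq_trans (\sum_y (s y != t y) * confusion t s (t y) (t y))).
  rewrite mulnC big_distrl leq_sum //= => y _.
  by case: (s y != t y); rewrite ?mul0n // !mul1n hi.
under eq_bigr => y _ do rewrite big_distrr /=.
rewrite exchange_big /= [leqRHS]big_mkcond /= leq_sum // => x _.
case: (boolP (s x == t x)) => /= sx; last first.
  rewrite big1 // => y _; case: (boolP (t x == t y)) => /= [/eqP <-|];
  by rewrite ?(negbTE sx) muln0.
rewrite -(conf x) addKn leq_sum // => y _; rewrite (eqP sx) andbb.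
by case: (boolP (t x == t y)) => [/eqP <-|_];
  rewrite ?muln0 ?eqxx ?muln1.
Qed.

(** Each of the [n] vertices of community [i] already contributes at least [n / q]. *)
Lemma unmatched_far s t q i : fibers_card t ->
  (forall j, n <= q * (n - confusion t s i j)) ->
  n * n <= q * unmatched t s.
Proof.
move=> nt hi; rewrite -{1}(nt i) big_distrl big_distrr leq_sum //= => x _.
by case: eqP => [->|_]; rewrite ?mul0n ?mul1n.
Qed.

(** Two rows cannot both have a large entry in one column, since the column sum [n] is below [2 h];
    so the choice of columns is injective. *)
Lemma confusion_match s t h : n < h.*2 -> fibers_card s ->
  (forall i, exists j, h <= confusion t s i j) ->
  exists p : {perm I}, forall i, h <= confusion t s i (p i).
Proof.
move=> nh ns hij; have [f hf] := boolp.choice hij.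
suff inj : injective f by exists (perm inj) => i; rewrite permE.
move=> i i' e; apply/eqP/negPn/negP => ii'.
have := hf i; have := hf i'; rewrite -e.
suff : confusion t s i (f i) + confusion t s i' (f i) <= n by lia.
rewrite -(ns (f i)) -big_split leq_sum // => x _ /=.
case: (s x == f i); rewrite ?andbF ?andbT //.
by case: (t x =P i) => [->|_]; rewrite ?(negbTE ii') // leq_b1.
Qed.
End Confusion.

(** Swapping coordinates exchanges the two orders of a pair, and diagonal pairs contribute 0. *)
Lemma changed_pairs_double (K n : nat) (s t : {ffun vtx K n -> 'I_K}) :
  (changed_pairs s t).*2 =
  (\sum_x \sum_y ((s x == s y) != (t x == t y)))%N.
Proof.
pose g (p : vtx K n * vtx K n) : nat :=
  ((s p.1 == s p.2) != (t p.1 == t p.2)).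
pose before (p : vtx K n * vtx K n) := (enum_rank p.1 < enum_rank p.2)%N.
have -> : changed_pairs s t = (\sum_(p | before p) g p)%N.
  rewrite (reindex_omap (val : upair K n -> _) insub) => [|p bp].
    by apply: eq_bigl => e /=; rewrite /before (valP e) valK eqxx.
  by rewrite (insubT before bp).
rewrite pair_big /= [RHS](bigID before) /= -addnn; congr addn.
have swapK : involutive (fun p : vtx K n * vtx K n => (p.2, p.1)) by case.
rewrite (reindex_inj (inv_inj swapK)) [RHS]big_mkcond [LHS]big_mkcond /=.
apply: eq_bigr => -[x y] _; rewrite /g /before /=.
rewrite (eq_sym (s y)) (eq_sym (t y)).
case: ltngtP => // /val_inj/enum_rank_inj ->.
by rewrite !eqxx.
Qed.

Lemma balanced_fibers (K n : nat) (s : {ffun vtx K n -> 'I_K}) :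
  balanced s <-> fibers_card n s.
Proof.
have card k : #|finset (fun x => s x == k)| = (\sum_x (s x == k))%N.
  by rewrite -sum1_card big_mkcond /=; apply: eq_bigr => x _; rewrite inE.
split=> [/forallP bs k|ns]; first by rewrite -card; apply/eqP.
by apply/forallP => k; rewrite card ns.
Qed.

Lemma truth_fibers (K n : nat) : fibers_card n (truth K n).
Proof.
move=> k; under eq_bigr => x _ do rewrite ffunE.
rewrite -(pair_big xpredT xpredT (fun i (j : 'I_n) => nat_of_bool (i == k))) /=.
rewrite (bigD1 k) //= [X in addn _ X]big1 => [|i /negbTE ik].
  by rewrite eqxx sum_nat_const card_ord muln1 addn0.
by rewrite ik sum_nat_const muln0.
Qed.

Lemma changed_pairs_unmatched (K n : nat) (s : {ffun vtx K n -> 'I_K}) :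
  balanced s -> changed_pairs s (truth K n) = unmatched n (truth K n) s.
Proof.
move=> /balanced_fibers ns; apply: double_inj.
by rewrite changed_pairs_double (sum_changed_pairs ns) //; exact: truth_fibers.
Qed.

(** The sum factors over vertices: each gives 1 for the label [t x] and [r] for every other label,
    so at most [1 + #|I| r <= expR (#|I| r)]. *)
Lemma sum_hamming_le (R : realType) (V I : finType) (t : {ffun V -> I})
    (r : R) : 0 <= r ->
  \sum_(s : {ffun V -> I}) r ^+ (\sum_x (s x != t x))%N <= expR (#|I|%:R * r * #|V|%:R).
Proof.
move=> r0; under eq_bigr => s _ do rewrite expr_sum.
rewrite -(bigA_distr_bigA (fun x i => r ^+ (i != t x))).
rewrite mulrC expRM_natl -prodr_const; apply: ler_prod => x _.
rewrite sumr_ge0 => /= [|i _]; last by rewrite exprn_ge0.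
apply: le_trans (expR_ge1Dx _); rewrite (bigD1 (t x)) //= eqxx expr0 lerD2l.
rewrite mulr_natl -sumr_const big_mkcond /=; apply: ler_sum => i _.
by case: eqP => //= _; rewrite expr1.
Qed.

(** * Union bound over far and near competitors *)

Section UnionBound.
Variables (R : realType) (K L n q : nat) (a b : 'I_L -> R).
Hypotheses (n0 : (0 < n)%N) (q3 : (2 < q)%N).
Hypotheses (a0 : forall l, 0 <= a l) (b0 : forall l, 0 <= b l).
Hypothesis a1 : (\sum_l a l) * ln (n%:R) / n%:R <= 1.
Hypothesis b1 : (\sum_l b l) * ln (n%:R) / n%:R <= 1.
Implicit Types s : {ffun vtx K n -> 'I_K}.

Let tr := truth K n.
(** This is [(1 - 1/q) n] rounded up; [2 < q] makes it exceed [n / 2], as the matching of rows to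
    columns requires. *)
Let h := (n - n %/ q)%N.
Let near s := [forall i, (h <= confusion tr s i i)%N].
Let far s := [exists i, forall j, (confusion tr s i j < h)%N].
Let competitor s := balanced s && (far s || (s != tr) && near s).

Let n_lt_h2 : (n < h.*2)%N.
Proof. have := leq_trunc_div n q; rewrite /h; nia. Qed.

Lemma competitor_repr s : balanced s -> ~~ same_partition s tr ->
  exists2 s', competitor s' & forall x y, (s x == s y) = (s' x == s' y).
Proof.
move=> bs ns; case: (boolP (far s)) => fs.
  by exists s => //; rewrite /competitor bs fs.
have [i|p hp] := confusion_match (t := tr) n_lt_h2
  (iffLR (balanced_fibers s) bs).
  move: fs; rewrite negb_exists => /forallP/(_ i).
  by rewrite negb_forall => /existsP[j]; rewrite -leqNgt => ?; exists j.
(* Relabelling by the inverse of [p] moves the large entries to the diagonal. *)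
pose s' : {ffun vtx K n -> 'I_K} := [ffun x => (p^-1)%g (s x)].
have s'E x k : (s' x == k) = (s x == p k).
  by rewrite ffunE -(inj_eq (@perm_inj _ p)) permKV.
exists s' => [|x y]; last by rewrite s'E ffunE permKV.
apply/andP; split.
  apply/balanced_fibers => k; under eq_bigr => x _ do rewrite s'E.
  exact: (iffLR (balanced_fibers s) bs).
apply/orP; right; apply/andP; split.
  apply: contra ns => /eqP e; apply/existsP; exists p; apply/forallP => x.
  by rewrite -s'E e.
apply/forallP => i; apply: leq_trans (hp i) _.
by apply: leq_sum => x _; rewrite s'E.
Qed.

Let rho : R := expR (- (divergence a b / 2 * (ln n%:R / n%:R))).

Let div0 : 0 <= divergence a b.
Proof. by apply: sumr_ge0 => l _; exact: sqr_ge0. Qed.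

Let rho_le1 : rho <= 1.
Proof.
by rewrite -expR0 ler_expR oppr_le0 mulr_ge0 ?divr_ge0 ?ln_nat_ge0.
Qed.

Let err_ge0 s : 0 <= error_prob a b tr s.
Proof. by apply: sumr_ge0 => w _; exact: lik_ge0. Qed.

Lemma sum_error_far : \sum_(s | balanced s && far s) error_prob a b tr s <=
  expR (n%:R * (K%:R * ln K%:R - divergence a b / (2 * q%:R) * ln n%:R)).
Proof.
(* With no communities there is no far labelling; otherwise [K = expR (ln K)] is available for
   counting the [K ^ (K n)] labellings. *)
have [K0|K0] := posnP K.
  rewrite big1 ?expR_ge0 // => s /andP[_ /existsP[k]].
  by have := ltn_ord k; rewrite {2}K0.
have bound s : balanced s && far s -> error_prob a b tr s <=
    expR (- (n%:R * (divergence a b / (2 * q%:R) * ln n%:R))).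
  case/andP => bs /existsP[i /forallP fs].
  apply: le_trans (error_prob_le n0 a0 b0 a1 b1 _ _) _.
  rewrite changed_pairs_unmatched // -expRM_natl ler_expR.
  have : (n * n <= q * unmatched n tr s)%N.
    apply: (unmatched_far (i := i) (@truth_fibers K n)) => j.
    have q0 : (0 < q)%N by lia.
    (* An entry below [h] leaves at least [n %/ q + 1] vertices, and the extra 1 makes up for the
       floor. *)
    apply: leq_trans (ltnW (ltn_ceil n q0)) _; rewrite mulnC leq_mul2l.
    by apply/orP; right; rewrite ltn_subRL addnC -ltn_subRL; exact: fs.
  rewrite -(ler_nat R) !natrM; set m : R := (unmatched _ _ _)%:R => hm.
  have nR : 0 < n%:R :> R by rewrite ltr0n.
  have qR : 0 < q%:R :> R by rewrite ltr0n; lia.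
  rewrite mulrN lerN2.
  rewrite [leLHS](_ : _ = (divergence a b / 2 * ln n%:R / (q%:R * n%:R)) *
    (n%:R * n%:R)); last by field; rewrite !gt_eqF.
  rewrite [leRHS](_ : _ = (divergence a b / 2 * ln n%:R / (q%:R * n%:R)) *
    (q%:R * m)); last by field; rewrite !gt_eqF.
  rewrite ler_wpM2l //.
  by rewrite !mulr_ge0 ?ln_nat_ge0 // ?invr_ge0 ?mulr_ge0 // ltW.
apply: le_trans (ler_sum _ bound) _.
rewrite big_mkcond; apply: le_trans (_ : _ <= \sum_(s : {ffun vtx K n -> 'I_K})
    expR (- (n%:R * (divergence a b / (2 * q%:R) * ln n%:R)))) _.
  by apply: ler_sum => s _; case: ifP => // _; exact: expR_ge0.
rewrite sumr_const card_ffun card_prod !card_ord -[leLHS]mulr_natl mulrBr expRD.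
rewrite ler_wpM2r ?expR_ge0 // natrX mulrA -natrM expRM_natl lnK ?posrE ?ltr0n //.
by rewrite mulnC.
Qed.

Lemma sum_error_near :
  \sum_(s | balanced s && ((s != tr) && near s)) error_prob a b tr s <=
  expR (K%:R * K%:R * expR ((1 - divergence a b * (1 - q%:R^-1)) * ln n%:R)) - 1.
Proof.
(* Each misplaced vertex costs at least [2 h] changed pairs. *)
pose r := rho ^+ (2 * h).
have r0 : 0 <= r by rewrite exprn_ge0 ?expR_ge0.
have bound s : balanced s && ((s != tr) && near s) ->
    error_prob a b tr s <= r ^+ (\sum_x (s x != tr x))%N.
  case/andP => bs /andP[_ /forallP ns].
  apply: le_trans (error_prob_le n0 a0 b0 a1 b1 _ _) _.
  rewrite -/rho -exprM; apply: ler_wiXn2l => //; first exact: expR_ge0.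
  by rewrite changed_pairs_unmatched // unmatched_near //; exact: truth_fibers.
apply: le_trans (ler_sum _ bound) _.
rewrite lerBrDr; apply: (@le_trans _ _ (expR (K%:R * r * (K * n)%:R))).
  have := sum_hamming_le tr r0; rewrite card_prod !card_ord; apply: le_trans.
  (* The truth is at distance 0, so its term is the 1 subtracted in the bound. *)
  rewrite [leRHS](bigD1 tr) //=.
  rewrite [X in r ^+ X + _]big1 ?expr0 => [|x _]; last by rewrite eqxx.
  rewrite addrC lerD2l [leRHS]big_mkcond [leLHS]big_mkcond /=.
  apply: ler_sum => s _; case: (s != tr); rewrite ?andbF //=.
  by case: ifP => // _; rewrite exprn_ge0.
rewrite ler_expR natrM [leLHS](_ : _ = K%:R * K%:R * (n%:R * r)); last by ring.
rewrite ler_wpM2l ?mulr_ge0 //.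
have nR : 0 < n%:R :> R by rewrite ltr0n.
have qR : 0 < q%:R :> R by rewrite ltr0n; lia.
rewrite -{1}(lnK (x := n%:R)) ?posrE // /r /rho -expRM_natl -expRD ler_expR.
rewrite mulrBl mul1r lerD2l mulrN lerN2.
have : (n * (q - 1) <= h * q)%N by have := leq_trunc_div n q; rewrite /h; nia.
rewrite -(ler_nat R) !natrM natrB; last by lia.
move=> hq.
rewrite [leLHS](_ : _ = (divergence a b * ln n%:R / (n%:R * q%:R)) *
  (n%:R * (q%:R - 1%:R))); last by field; rewrite !gt_eqF.
rewrite [leRHS](_ : _ = (divergence a b * ln n%:R / (n%:R * q%:R)) *
  (h%:R * q%:R)); last by field; rewrite !gt_eqF.
rewrite ler_wpM2l //.
by rewrite !mulr_ge0 ?ln_nat_ge0 // invr_ge0 mulr_ge0 // ltW.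
Qed.

Lemma prob_success_lower :
  1 - (expR (n%:R * (K%:R * ln K%:R - divergence a b / (2 * q%:R) * ln n%:R)) +
       (expR (K%:R * K%:R *
          expR ((1 - divergence a b * (1 - q%:R^-1)) * ln n%:R)) - 1)) <=
  prob_success K a b n.
Proof.
apply: le_trans (prob_success_ge n0 a0 b0 a1 b1 competitor_repr).
rewrite lerD2l lerN2; apply: le_trans (lerD sum_error_far sum_error_near).
rewrite [leLHS]big_mkcond [X in X + _]big_mkcond [X in _ + X]big_mkcond.
rewrite -big_split /=; apply: ler_sum => s _; rewrite /competitor.
case: (balanced s); case: (far s); case: (_ && near s) => /=;
  by rewrite ?add0r ?addr0 // lerDl.
Qed.
End UnionBound.

(** * Asymptotics as [n] tends to infinity *)

Lemma ln_natr_cvgy (R : realType) : (ln n%:R : R) @[n --> \oo] --> +oo.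
Proof.
apply/cvgryPge => A; near=> n.
have An : expR A <= n%:R by near: n; exact: nbhs_infty_ger.
by rewrite -(expRK A) ler_ln ?posrE ?expR_gt0 // (lt_le_trans (expR_gt0 A)).
Unshelve. all: by end_near. Qed.

(** With [n = r ^ 2], [u ln n = 2 u ln r <= 2 u r <= r ^ 2] once [2 u <= r]. *)
Lemma near_mul_ln_le1 (R : realType) (u : R) : 0 <= u ->
  \forall n \near \oo, u * ln n%:R / n%:R <= 1.
Proof.
move=> u0; near=> n.
have n0 : 0 < n%:R :> R by rewrite ltr0n; near: n; exact: nbhs_infty_gt.
have un : (2 * u) ^+ 2 <= n%:R by near: n; exact: nbhs_infty_ger.
rewrite ler_pdivrMr // mul1r.
set r := Num.sqrt (n%:R : R); have r0 : 0 < r by rewrite sqrtr_gt0.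
have nr : n%:R = r ^+ 2 by rewrite sqr_sqrtr // ltW.
have ur : 2 * u <= r.
  by rewrite -(ger0_norm (mulr_ge0 (ler0n _ 2) u0)) -sqrtr_sqr ler_wsqrtr.
have := ltW (ln_sublinear r0); rewrite nr lnXn //; nra.
Unshelve. all: by end_near. Qed.

Lemma cvg_expRNM_ln (R : realType) (d : R) : 0 < d ->
  expR (- d * ln n%:R) @[n --> \oo] --> (0 : R).
Proof.
move=> d0; under eq_fun do rewrite mulNr.
apply: (cvg_comp (fun n : nat => d * ln n%:R) (fun x : R => expR (- x)));
  last exact: cvgr_expR.
apply/cvgryPge => A; near=> n.
rewrite -ler_pdivrMl //; near: n.
by move/cvgryPge: (@ln_natr_cvgy R); apply.
Unshelve. all: by end_near. Qed.

Lemma cvg_expR_superlinear (R : realType) (c d : R) : 0 < d ->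
  expR (n%:R * (c - d * ln n%:R)) @[n --> \oo] --> (0 : R).
Proof.
move=> d0; apply: (@squeeze_cvgr _ _ _ _ (cst 0) (fun n => expR (- n%:R))).
- near=> n; rewrite expR_ge0 ler_expR /=.
  (* From this point on the exponent is at most [- n]. *)
  have : (c + 1) / d <= ln n%:R.
    by near: n; move/cvgryPge: (@ln_natr_cvgy R); apply.
  rewrite ler_pdivrMr // => h; rewrite -mulrN1 ler_wpM2l //; lra.
- exact: cvg_cst.
- apply: (cvg_comp (fun n : nat => n%:R) (fun x : R => expR (- x))).
    exact: cvgr_idn.
  exact: cvgr_expR.
Unshelve. all: by end_near. Qed.

Unset Implicit Arguments.

Theorem theorem3 (R : realType) (K L : nat) (hK : (2 <= K)%N) (hL : (1 <= L)%N)
    (a b : 'I_L -> R) (ha : forall l, 0 <= a l) (hb : forall l, 0 <= b l)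
    (hcond : 1 < \sum_(l < L) (Num.Def.sqrtr (a l) - Num.Def.sqrtr (b l)) ^+ 2) :
  (fun n : nat => @prob_success R K L a b n) @ \oo --> (1 : R).
Proof.
have D1 : 1 < divergence a b by [].
set D := divergence a b in D1.
(* [D (1 - 1/q) > 1] amounts to [q > D / (D - 1)]; adding 3 also gives [2 < q]. *)
pose q := (Num.bound (D / (D - 1))).+3.
have q0 : 0 < q%:R :> R by rewrite ltr0n.
have Dq : 1 < D * (1 - q%:R^-1).
  have : D / (D - 1) < q%:R.
    apply: lt_trans (archi_boundP _) _; first by rewrite divr_ge0; lra.
    by rewrite ltr_nat; lia.
  rewrite ltr_pdivrMr ?subr_gt0 // => h.
  rewrite -(ltr_pM2r q0) mul1r (_ : _ * q%:R = D * (q%:R - 1)).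
    by nra.
  by field; rewrite gt_eqF.
apply: (squeeze_cvgr (f := fun n : nat =>
  1 - (expR (n%:R * (K%:R * ln K%:R - D / (2 * q%:R) * ln n%:R)) +
       (expR (K%:R * K%:R * expR ((1 - D * (1 - q%:R^-1)) * ln n%:R)) - 1)))
  (h := cst 1)); last exact: cvg_cst.
  near=> n.
  have n0 : (0 < n)%N by near: n; exact: nbhs_infty_gt.
  (* Nonnegativity of the color 0 probabilities is guaranteed only for large [n], so the bounds hold
     eventually. *)
  have a1 : (\sum_l a l) * ln n%:R / n%:R <= 1.
    by near: n; apply: near_mul_ln_le1; exact: sumr_ge0.
  have b1 : (\sum_l b l) * ln n%:R / n%:R <= 1.
    by near: n; apply: near_mul_ln_le1; exact: sumr_ge0.
  by rewrite prob_success_lower // prob_success_le1.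
rewrite -[X in _ --> X]subr0; apply: cvgB; first exact: cvg_cst.
rewrite -[X in _ --> X]addr0; apply: cvgD.
  by apply: cvg_expR_superlinear; rewrite divr_gt0 ?mulr_gt0 //; lra.
rewrite -[X in _ --> X](subrr 1); apply: cvgB; last exact: cvg_cst.
rewrite -[X in _ --> X]expR0; apply: continuous_cvg.
  exact: continuous_expR.
rewrite -[X in _ --> X](mulr0 (K%:R * K%:R)); apply: cvgMr.
rewrite -[1 - _]opprK opprB; apply: cvg_expRNM_ln; lra.
Unshelve. all: by end_near. Qed.
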